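(* There exist a probability measure $P$ on $\Omega=\{0,1\}^{\mathbb{N}}$ and a sequence $\omega\in\Omega$ such that $\omega$ is blindly (oracle-free) random with respect to $P$ but is not uniformly random with respect to $P$.
   Context: A function $t:\Omega\to[0,\infty]$ is lower semicomputable if each $\{\omega:r<t(\omega)\}$ ($r$ rational) is a union of an enumerable family of intervals $x\Omega$, uniformly in $r$. A blind test for $P$ is a lower semicomputable $t$ with $\int t\,dP\le1$; $\omega$ is blindly random w.r.t. $P$ if all blind tests for $P$ are finite at $\omega$. $\mathcal{M}(\Omega)$ is the space of probability measures with basic sets given by finitely many conditions $u<Q(y)<v$ ($u,v$ rational); basic open sets of $\Omega\times\mathcal{M}(\Omega)$ are $x\Omega\times\beta$, and lower semicomputability on this product is defined analogously. A uniform test is a lower semicomputable $t(\omega,Q)\ge0$ with $\int t(\omega,Q)\,dQ(\omega)\le1$ for all $Q$; with $\mathbf{t}$ a universal (maximal up to a multiplicative constant) uniform test, $\omega$ is uniformly random w.r.t. $P$ iff $\mathbf{t}(\omega,P)<\infty$. *)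

(* Defs.v *)
From HB Require Import structures.
From mathcomp Require Import all_boot all_order all_algebra.
From mathcomp Require Import all_classical all_reals all_analysis.

Set Implicit Arguments.
Unset Strict Implicit.
Unset Printing Implicit Defensive.

Import Order.TTheory GRing.Theory Num.Theory.

Local Open Scope classical_set_scope.
Local Open Scope ring_scope.
Local Open Scope ereal_scope.

(* Bijective pairing: (npair a b).+1 = 2 ^ a * (2 * b + 1). *)
Definition npair (a b : nat) : nat := (2 ^ a * b.*2.+1).-1.
Definition nfst (n : nat) : nat := logn 2 n.+1.
Definition nsnd (n : nat) : nat := (n.+1 %/ 2 ^ nfst n)./2.

Lemma nfst_npair a b : nfst (npair a b) = a.
Proof.
rewrite /nfst /npair prednK ?muln_gt0 ?expn_gt0 //.
by rewrite lognM ?expn_gt0 // lognX lognE /= muln1 lognE /= dvdn2 /= odd_double addn0.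
Qed.

Lemma nsnd_npair a b : nsnd (npair a b) = b.
Proof.
rewrite /nsnd nfst_npair /npair prednK ?muln_gt0 ?expn_gt0 //.
by rewrite mulKn ?expn_gt0 //= uphalf_double.
Qed.

Lemma npair_nfst_nsnd n : npair (nfst n) (nsnd n) = n.
Proof.
have dvd_n : (2 ^ nfst n %| n.+1)%N by rewrite pfactor_dvdn.
have odd_n : odd (n.+1 %/ 2 ^ nfst n).
  rewrite -[odd _]negbK -dvdn2; apply/negP => dvd2.
  have : (2 ^ (nfst n).+1 %| n.+1)%N.
    by rewrite expnSr -(divnK dvd_n) mulnC dvdn_mul // mulnC.
  by rewrite pfactor_dvdn // ltnn.
have := odd_double_half (n.+1 %/ 2 ^ nfst n); rewrite odd_n add1n => e.
by rewrite /npair /nsnd e mulnC divnK.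
Qed.

(* Kleene's partial recursive functions, presented as unary functions: a
   function of several arguments takes their [npair] as its input. *)
Inductive prf : Type :=
| PRzero
| PRsucc
| PRfst
| PRsnd
| PRpair of prf & prf
| PRcomp of prf & prf
| PRprim of prf & prf
| PRmin of prf.

(* [prf_eval c n m]: the computation of [c] on input [n] halts with value [m].
   [PRprim f g] is h with h(x,0) = f(x) and h(x,k+1) = g(x,(k,h(x,k)));
   [PRmin f] maps x to the least m with f(x,m) = 0, all f(x,j), j < m, being
   defined. *)
Fixpoint prf_eval (c : prf) (n m : nat) {struct c} : Prop :=
  match c with
  | PRzero => m = 0%N
  | PRsucc => m = n.+1
  | PRfst => m = nfst n
  | PRsnd => m = nsnd n
  | PRpair f g => exists a b,
      [/\ prf_eval f n a, prf_eval g n b & m = npair a b]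
  | PRcomp f g => exists2 a, prf_eval g n a & prf_eval f a m
  | PRprim f g =>
      (fix prim (k m : nat) {struct k} : Prop :=
         match k with
         | 0%N => prf_eval f (nfst n) m
         | k'.+1 => exists2 p, prim k' p &
                      prf_eval g (npair (nfst n) (npair k' p)) m
         end) (nsnd n) m
  | PRmin f =>
      prf_eval f (npair n m) 0%N /\
      forall j, (j < m)%N -> exists i, prf_eval f (npair n j) i.+1
  end.

Fixpoint code_seq (T : Type) (code : T -> nat) (s : seq T) : nat :=
  if s is x :: s' then (npair (code x) (code_seq code s')).+1 else 0%N.

Definition code_word : seq bool -> nat := code_seq nat_of_bool.

Definition code_int (z : int) : nat :=
  match z with Posz n => npair 0 n | Negz n => npair 1 n end.

Definition code_rat (r : rat) : nat :=
  npair (code_int (numq r)) (code_int (denq r)).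

(* [enumerated code c r] is the family of objects listed by the algorithm [c]
   run on the parameter [r] and on n = 0, 1, 2, ... (it may diverge on some n,
   so that the family may be empty). *)
Definition enumerated (T : Type) (code : T -> nat) (c : prf) (r : rat) : set T :=
  [set x | exists n, prf_eval c (npair (code_rat r) n) (code x)].

Definition cylinder (x : seq bool) : set (nat -> bool) :=
  [set w | forall i, (i < size x)%N -> w i = nth false x i].

(* {0,1}^N with its Borel sigma-algebra, generated by the intervals. *)
Definition Omega := g_sigma_algebraType (range cylinder).

Definition lower_semicomputable (R : realType) (t : Omega -> \bar R) : Prop :=
  (forall w, 0 <= t w) /\
  exists c : prf, forall r : rat,
    [set w | (ratr r)%:E < t w] =
    \bigcup_(x in enumerated code_word c r) cylinder x.

Definition blind_test (R : realType) (P : probability Omega R)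
    (t : Omega -> \bar R) : Prop :=
  lower_semicomputable t /\ \int[P]_w t w <= 1.

Definition blindly_random (R : realType) (P : probability Omega R)
    (w : Omega) : Prop :=
  forall t, blind_test P t -> t w < +oo.

(* The list of the (y, u, v) stands for the conditions u < Q(y) < v. *)
Definition conditions : Type := seq (seq bool * rat * rat).

Definition code_conditions : conditions -> nat :=
  code_seq (fun b => npair (code_word b.1.1)
                           (npair (code_rat b.1.2) (code_rat b.2))).

Definition basic_measures (R : realType) (beta : conditions) :
    set (probability Omega R) :=
  [set Q | forall y u v, (y, u, v) \in beta ->
             (ratr u)%:E < Q (cylinder y) < (ratr v)%:E].

Definition code_basic (b : seq bool * conditions) : nat :=
  npair (code_word b.1) (code_conditions b.2).

Definition lower_semicomputable2 (R : realType)
    (t : Omega -> probability Omega R -> \bar R) : Prop :=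
  (forall w Q, 0 <= t w Q) /\
  exists c : prf, forall r : rat,
    [set wQ | (ratr r)%:E < t wQ.1 wQ.2] =
    \bigcup_(b in enumerated code_basic c r)
      (cylinder b.1 `*` @basic_measures R b.2).

Definition uniform_test (R : realType)
    (t : Omega -> probability Omega R -> \bar R) : Prop :=
  lower_semicomputable2 t /\ forall Q : probability Omega R, \int[Q]_w t w Q <= 1.

Definition universal_uniform_test (R : realType)
    (t : Omega -> probability Omega R -> \bar R) : Prop :=
  uniform_test t /\
  forall t', uniform_test t' ->
    exists2 a : R, (0 < a)%R & forall w Q, t' w Q <= a%:E * t w Q.

(* The choice of the universal test is immaterial: see [uniformly_randomE]. *)
Definition uniformly_random (R : realType) (P : probability Omega R)
    (w : Omega) : Prop :=
  exists2 t : Omega -> probability Omega R -> \bar R,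
    universal_uniform_test t & t w P < +oo.

Lemma uniformly_randomE (R : realType)
    (t : Omega -> probability Omega R -> \bar R) (P : probability Omega R)
    (w : Omega) :
  universal_uniform_test t -> uniformly_random P w <-> t w P < +oo.
Proof.
move=> tU; split=> [[t' [_ t'U] t'P]|]; last by exists t.
have [a a0 le_t] := t'U _ tU.1.
by rewrite (le_lt_trans (le_t w P))// lte_mul_pinfty// lee_fin ltW.
Qed.

(* Main.v *)
Require Import Defs.
From HB Require Import structures.
From mathcomp Require Import all_boot all_order all_algebra.
From mathcomp Require Import all_classical all_reals all_analysis.
From mathcomp Require Import measurable_realfun zify ring.

(** A blind test does not know how fast [P] decreases along the prefixes of
    [w = 111...]. Enumerate all the algorithms [c_k], let [p_k > 0] be the
    weights of a Poisson law and let [r_k * p_k > 1]. If [c_k] enumerates an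
    open set [t > r_k] that contains [w], this set contains some interval
    [1^(N_k) Omega]; hence if [P] is the sum of the [p_k]-weighted Dirac
    masses at [1^(N_k) 000...], then [t] has [P]-integral greater than [1]:
    every blind test for [P] is finite at [w]. But [P {w} = 0], which a uniform test reads off [P]: it
    counts the [k > 0] such that [Q (1^n Omega) < 3 / 4^k] for some prefix [1^n]
    of its argument. *)

Set Implicit Arguments.
Unset Strict Implicit.
Unset Printing Implicit Defensive.

Import Order.TTheory GRing.Theory Num.Theory.

Local Open Scope classical_set_scope.

(** * Total recursive functions and their closure properties *)

Definition recursive (f : nat -> nat) : Prop :=
  exists c, forall n m, prf_eval c n m <-> m = f n.

Lemma recursive_ext f g : f =1 g -> recursive f -> recursive g.
Proof. by move=> /funext ->. Qed.

Lemma recursive_fst : recursive nfst.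
Proof. by exists PRfst. Qed.

Lemma recursive_snd : recursive nsnd.
Proof. by exists PRsnd. Qed.

Lemma recursive_comp f g : recursive f -> recursive g -> recursive (f \o g).
Proof.
move=> [cf fP] [cg gP]; exists (PRcomp cf cg) => n m /=; split.
  by move=> [a /gP -> /fP].
by move=> ->; exists (g n); [apply/gP|apply/fP].
Qed.

Lemma recursive_succ f : recursive f -> recursive (fun n => (f n).+1).
Proof. by move=> rf; apply: (@recursive_comp succn) => //; exists PRsucc. Qed.

Lemma recursive_pair f g :
  recursive f -> recursive g -> recursive (fun n => npair (f n) (g n)).
Proof.
move=> [cf fP] [cg gP]; exists (PRpair cf cg) => n m /=; split.
  by move=> [a [b [/fP -> /gP -> ->]]].
by move=> ->; exists (f n), (g n); split => //; [apply/fP|apply/gP].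
Qed.

Lemma recursive_id : recursive id.
Proof.
apply: recursive_ext (recursive_pair recursive_fst recursive_snd) => n.
exact: npair_nfst_nsnd.
Qed.

Lemma recursive_const k : recursive (fun=> k).
Proof. by elim: k => [|k /recursive_succ //]; exists PRzero. Qed.

(** [PRprim] reads its parameter and its counter from one paired input, so the recursion is built on
    pairs as [h] and then composed with n -> [npair n (k n)]. *)
Lemma recursive_nat_rect (f k : nat -> nat) (g : nat -> nat -> nat -> nat) :
  recursive f -> recursive k ->
  recursive (fun z => g (nfst z) (nfst (nsnd z)) (nsnd (nsnd z))) ->
  recursive (fun n => nat_rect (fun=> nat) (f n) (g n) (k n)).
Proof.
move=> [cf fP] rk [cg gP].
pose h z := nat_rect (fun=> nat) (f (nfst z)) (g (nfst z)) (nsnd z).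
suff rh : recursive h.
  apply: recursive_ext (recursive_comp rh (recursive_pair recursive_id rk)).
  by move=> n /=; rewrite /h nfst_npair nsnd_npair.
exists (PRprim cf cg) => n m; rewrite /h /=.
elim: (nsnd n) m => [|j IH] m /=; first exact: fP.
split=> [[p /IH -> /gP ->]|->]; first by rewrite !(nfst_npair, nsnd_npair).
exists (nat_rect (fun=> nat) (f (nfst n)) (g (nfst n)) j); first exact/IH.
by apply/gP; rewrite !(nfst_npair, nsnd_npair).
Qed.

Lemma recursive_pred f : recursive f -> recursive (fun n => (f n).-1).
Proof.
move=> rf; apply: (@recursive_ext
  (fun n => nat_rect (fun=> nat) 0 (fun j _ => j) (f n))).
  by move=> n; case: (f n).
apply: (@recursive_nat_rect (fun=> 0) f (fun _ j _ => j)) => //.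
  exact: recursive_const.
exact: recursive_comp recursive_fst recursive_snd.
Qed.

Lemma recursive_sub f g :
  recursive f -> recursive g -> recursive (fun n => f n - g n).
Proof.
move=> rf rg; apply: (@recursive_ext
  (fun n => nat_rect (fun=> nat) (f n) (fun _ p => p.-1) (g n))).
  by move=> n; elim: (g n) => [|k /= ->]; rewrite ?subn0 ?subnS.
apply: (@recursive_nat_rect f g (fun _ _ p => p.-1)) => //.
exact: recursive_pred (recursive_comp recursive_snd recursive_snd).
Qed.

(** Iterated subtraction; this is the shape that comparing a coded rational with an integer
    takes. *)
Lemma recursive_submul f g h : recursive f -> recursive g -> recursive h ->
  recursive (fun n => f n - g n * h n).
Proof.
move=> rf rg rh; apply: (@recursive_ext
  (fun n => nat_rect (fun=> nat) (f n) (fun _ p => p - h n) (g n))).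
  move=> n; elim: (g n) => [|k /= ->]; first by rewrite mul0n subn0.
  by rewrite mulSn; lia.
apply: (@recursive_nat_rect f g (fun n _ p => p - h n)) => //.
apply: recursive_sub; first exact: recursive_comp recursive_snd recursive_snd.
exact: recursive_comp rh recursive_fst.
Qed.

Lemma recursive_if f g h : recursive f -> recursive g -> recursive h ->
  recursive (fun n => if f n == 0 then g n else h n).
Proof.
move=> rf rg rh; apply: (@recursive_ext
  (fun n => nat_rect (fun=> nat) (g n) (fun _ _ => h n) (f n))).
  by move=> n; case: (f n).
apply: (@recursive_nat_rect g f (fun n _ _ => h n)) => //.
exact: recursive_comp rh recursive_fst.
Qed.

Lemma prf_restrict f g : recursive f -> recursive g ->
  exists c, forall n m, prf_eval c n m <-> g n = 0 /\ m = f n.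
Proof.
move=> [cf fP] [cg gP].
(* The body of the [PRmin] search ignores its candidate: the search halts at 0 if [g n = 0] and
   diverges otherwise. *)
exists (PRcomp PRsnd (PRpair (PRmin (PRcomp cg PRfst)) cf)) => n m /=; split.
  move=> [_ [a [b [[[_ -> /gP g0] _] /fP -> ->]]] ->].
  by rewrite nsnd_npair; rewrite nfst_npair in g0.
move=> [g0 ->]; exists (npair 0 (f n)); last by rewrite nsnd_npair.
exists 0, (f n); split => //; last exact/fP.
by split => //; exists n; [rewrite nfst_npair|apply/gP].
Qed.

(** * Injectivity of the codes *)

Lemma npair_inj a b a' b' : npair a b = npair a' b' -> a = a' /\ b = b'.
Proof.
by move=> e; split; [rewrite -(nfst_npair a b)|rewrite -(nsnd_npair a b)];
  rewrite e ?nfst_npair ?nsnd_npair.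
Qed.

Lemma code_seq_inj (T : Type) (code : T -> nat) :
  injective code -> injective (code_seq code).
Proof.
move=> codeI; elim=> [|x s IH] [|y s'] //= e.
by have [/codeI -> /IH ->] := npair_inj (succn_inj e).
Qed.

Lemma code_word_inj : injective code_word.
Proof. by apply: code_seq_inj => -[] []. Qed.

Lemma code_int_inj : injective code_int.
Proof. by move=> [m|m] [n|n] /npair_inj[] // _ ->. Qed.

Lemma code_rat_inj : injective code_rat.
Proof.
move=> q r /npair_inj[/code_int_inj en /code_int_inj ed].
by rewrite -(divq_num_den q) -(divq_num_den r) en ed.
Qed.

Lemma code_basic_inj : injective code_basic.
Proof.
move=> [x s] [y s'] /npair_inj[/code_word_inj /= -> e]; congr pair.
apply: code_seq_inj e => -[[z u] v] [[z' u'] v'] /npair_inj[/code_word_inj /=].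
by move=> -> /npair_inj[/code_rat_inj -> /code_rat_inj ->].
Qed.

(** Gives each algorithm its own index, hence its own Poisson weight in the diagonal
    construction. *)
Fixpoint code_prf (c : prf) : nat :=
  match c with
  | PRzero => npair 0 0
  | PRsucc => npair 1 0
  | PRfst => npair 2 0
  | PRsnd => npair 3 0
  | PRpair f g => npair 4 (npair (code_prf f) (code_prf g))
  | PRcomp f g => npair 5 (npair (code_prf f) (code_prf g))
  | PRprim f g => npair 6 (npair (code_prf f) (code_prf g))
  | PRmin f => npair 7 (code_prf f)
  end.

Lemma code_prf_inj : injective code_prf.
Proof.
elim=> [||||f If g Ig|f If g Ig|f If g Ig|f If];
  case=> [||||f' g'|f' g'|f' g'|f'] /npair_inj[] //.
- by move=> _ /npair_inj[/If -> /Ig ->].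
- by move=> _ /npair_inj[/If -> /Ig ->].
- by move=> _ /npair_inj[/If -> /Ig ->].
- by move=> _ /If ->.
Qed.

(** * Enumeration of the basic sets behind the uniform test *)

Definition ones (n : nat) : seq bool := nseq n true.

(* [bound 0 > 1] makes level [0] of the test trivially everything, while the sum
   over [k > 0] is [1]; [3] and [4 ^ k] are coprime, so the code is explicit. *)
Definition bound (k : nat) : rat := 3%:R / 4%:R ^+ k.

Local Open Scope ring_scope.

(** [npair 0 k] is 2k and [npair a 0] is 2^a - 1, so pairing alone produces the denominator 4^k. *)
Lemma code_rat_bound k :
  code_rat (bound k) = npair (npair 0 3) (npair 0 (npair (npair 0 k) 0).+1).
Proof.
have e : ((npair (npair 0 k) 0).+1 = 4 ^ k)%N.
  by rewrite /npair !mul1n muln1 prednK ?expn_gt0 //= -mul2n expnM.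
have c : coprime 3 (4 ^ k) by rewrite coprimeXr.
have d : bound k = (3%:Z)%:Q / ((4 ^ k)%N%:Z)%:Q.
  by rewrite /bound -!pmulrn natrX.
rewrite /code_rat d coprimeq_num // coprimeq_den // e.
by case: (4 ^ k)%N (expn_gt0 4 k).
Qed.

Lemma bound_antitone (R : numFieldType) (j k : nat) :
  (j <= k)%N -> ratr (bound k) <= ratr (bound j) :> R.
Proof.
move=> jk; rewrite /bound ler_rat ler_pM2l // lef_pV2 ?posrE ?exprn_gt0 //.
by rewrite ler_eXn2l.
Qed.

(** As the denominator is positive, r < k means num + 1 <= k * den. A negative numerator carries the
    tag 1, which replaces num + 1 by 0, and the comparison then always succeeds. *)
Lemma code_rat_lt_nat (r : rat) (k : nat) :
  (r < k%:R) =
  ((if nfst (nfst (code_rat r)) == 0 then (nsnd (nfst (code_rat r))).+1 else 0)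
     - k * nsnd (nsnd (code_rat r)) == 0)%N.
Proof.
rewrite /code_rat !(nfst_npair, nsnd_npair).
rewrite -{1}(divq_num_den r) ltr_pdivrMr ?ltr0z ?denq_gt0 //.
case: (denq r) (denq_gt0 r) => // d _; rewrite /= nsnd_npair.
case: (numq r) => n; rewrite /= nfst_npair ?nsnd_npair /=.
  by rewrite subn_eq0 -!pmulrn -natrM ltr_nat.
rewrite sub0n; apply: lt_le_trans (_ : 0 <= _); last by rewrite mulr_ge0.
by rewrite ltrz0.
Qed.

(** The lower limit -1 is void for a probability; only Q(1^n Omega) < [bound k] remains. *)
Definition basic_ones (k n : nat) : seq bool * conditions :=
  (ones n, [:: (ones n, -1, bound k)]).

Lemma enumerated_basic_ones : exists c, forall r,
  enumerated code_basic c r =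
  [set b | exists k n, r < k%:R /\ b = basic_ones k n].
Proof.
have rfs : recursive (fun z => nfst (nsnd z)).
  exact: recursive_comp recursive_fst recursive_snd.
have rss : recursive (fun z => nsnd (nsnd z)).
  exact: recursive_comp recursive_snd recursive_snd.
have rff : recursive (fun z => nfst (nfst z)).
  exact: recursive_comp recursive_fst recursive_fst.
have rsf : recursive (fun z => nsnd (nfst z)).
  exact: recursive_comp recursive_snd recursive_fst.
(* The input [z] is [npair (code_rat r) (npair k n)]; [test z] vanishes exactly when r < k. *)
pose test z := ((if nfst (nfst (nfst z)) == 0 then (nsnd (nfst (nfst z))).+1
  else 0) - nfst (nsnd z) * nsnd (nsnd (nfst z)))%N.
have rtest : recursive test.
  apply: recursive_submul => //; last first.
    exact: recursive_comp recursive_snd rsf.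
  apply: recursive_if; first exact: recursive_comp recursive_fst rff.
    exact/recursive_succ/(recursive_comp recursive_snd rff).
  exact: recursive_const.
pose out z := code_basic (basic_ones (nfst (nsnd z)) (nsnd (nsnd z))).
have rones : recursive (fun z => code_word (ones (nsnd (nsnd z)))).
  apply: (@recursive_ext (fun z => nat_rect (fun=> nat) 0%N
    (fun _ p => (npair 1 p).+1) (nsnd (nsnd z)))).
    by move=> z; elim: (nsnd (nsnd z)) => //= n ->.
  apply: (@recursive_nat_rect (fun=> 0%N) _
    (fun _ _ p => (npair 1 p).+1)) => //.
    exact: recursive_const.
  exact/recursive_succ/recursive_pair/rss/recursive_const.
have rout : recursive out.
  rewrite /out /code_basic /code_conditions /=.
  apply: recursive_pair => //; apply/recursive_succ/recursive_pair; last first.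
    exact: recursive_const.
  apply: recursive_pair => //; apply: recursive_pair.
    exact: recursive_const.
  apply: (recursive_ext (fun z => esym (code_rat_bound _))).
  apply: recursive_pair; first exact: recursive_const.
  apply: recursive_pair; first exact: recursive_const.
  apply/recursive_succ/recursive_pair; last exact: recursive_const.
  by apply: recursive_pair => //; exact: recursive_const.
(* The restricted algorithm diverges on the pairs with k <= r, so these are not listed. *)
have [c cP] := prf_restrict rout rtest.
exists c => r; apply/seteqP; split=> [b [n /cP[]]|b [k [n [rk ->]]]] /=.
  rewrite /test /out nfst_npair nsnd_npair => /eqP.
  rewrite -code_rat_lt_nat => rk /code_basic_inj ->.
  by exists (nfst n), (nsnd n).
exists (npair k n); apply/cP.
rewrite /test /out nfst_npair nsnd_npair (nfst_npair k) (nsnd_npair k).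
split=> //.
by apply/eqP; rewrite -code_rat_lt_nat.
Qed.

Local Open Scope ereal_scope.

(** * Intervals around 111.. *)

Lemma cylinder_onesE n (w : nat -> bool) :
  cylinder (ones n) w <-> forall i, (i < n)%N -> w i.
Proof.
rewrite /cylinder /= size_nseq; split=> h i im; have := h i im.
  by rewrite nth_nseq im.
by rewrite nth_nseq im => ->.
Qed.

Lemma cylinder_ones_antitone m n : (m <= n)%N ->
  cylinder (ones n) `<=` cylinder (ones m).
Proof.
move=> mn w /cylinder_onesE wn; apply/cylinder_onesE => i im.
exact/wn/(leq_trans im).
Qed.

Lemma cylinder_const_true x : cylinder x (fun=> true) -> x = ones (size x).
Proof.
move=> h; apply: (@eq_from_nth _ false) => [|i ix]; first by rewrite size_nseq.
by rewrite nth_nseq ix -h.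
Qed.

Lemma measurable_cylinder x : measurable (cylinder x : set Omega).
Proof. by apply: sub_sigma_algebra; exists x. Qed.

(** * The uniform test that detects a null point 111.. *)

Section ones_test.
Context {R : realType}.
Implicit Types (Q : probability Omega R) (w : Omega) (k n : nat).

Definition small_ones Q k : set Omega :=
  \bigcup_(n in [set n | Q (cylinder (ones n)) < (ratr (bound k))%:E])
    cylinder (ones n).

Definition ones_test w Q : \bar R :=
  \sum_(k <oo) (\1_(small_ones Q k.+1) w)%:E.

Lemma measurable_small_ones Q k : measurable (small_ones Q k).
Proof. by apply: bigcup_measurable => n _; exact: measurable_cylinder. Qed.

Lemma small_ones_antitone Q j k : (j <= k)%N ->
  small_ones Q k `<=` small_ones Q j.
Proof.
move=> jk w [n /= Qn wn]; exists n => //=.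
by rewrite (lt_le_trans Qn) // lee_fin bound_antitone.
Qed.

(** The intervals are nested, so the union lies in the one of least admissible index [m]; with no
    admissible index it is empty. *)
Lemma small_ones_le Q k : Q (small_ones Q k) <= (ratr (bound k))%:E.
Proof.
pose p n := `[< Q (cylinder (ones n)) < (ratr (bound k))%:E >].
have [exp|nexp] := pselect (exists n, p n); last first.
  rewrite (_ : small_ones Q k = set0) ?measure0.
    by rewrite lee_fin ler0q divr_ge0 // exprn_ge0.
  apply/seteqP; split=> // w [n /asboolP pn _]; apply: nexp.
  by exists n.
have [m /asboolP pm minm] := ex_minnP exp.
apply: le_trans (ltW pm); apply: le_measure.
- by rewrite inE; exact: measurable_small_ones.
- by rewrite inE; exact: measurable_cylinder.
- by move=> w [n /asboolP pn]; exact/cylinder_ones_antitone/minm.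
Qed.

(** The levels decrease, so a point of level k is counted at least k times. This makes each
    superlevel set a union of basic sets. *)
Lemma ones_test_gtP w Q (r : rat) : (ratr r)%:E < ones_test w Q <->
  exists k, (r < k%:R)%R /\ small_ones Q k w.
Proof.
have ge0 k : 0 <= (\1_(small_ones Q k.+1) w)%:E :> \bar R.
  by rewrite lee_fin indicE ler0n.
split=> [rt|[[|k] [rk wk]]].
- have [r0|r0] := ltP r 0%R.
    (* For r < 0 the empty prefix at level 0 serves: Q(Omega) = 1 < 3 = [bound 0]. *)
    exists 0%N; split=> //; exists 0%N => //=.
    rewrite (_ : cylinder _ = setT); last first.
      by apply/seteqP; split=> // v _; apply/cylinder_onesE.
    by rewrite probability_setT lte_fin /bound expr0 divr1 ratr_nat ltr1n.
  apply: contrapT => nex; move: rt; apply/negP; rewrite -leNgt.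
  (* Without a level beyond r containing [w], only the first [m] terms can be nonzero, and each is
     at most 1. *)
  set m := Num.truncn r.
  have /andP[mr rm] : (m%:R <= r < m.+1%:R)%R by exact: truncn_itv.
  rewrite /ones_test (nneseries_split 0 m) // add0n eseries0 => [|i mi _].
    rewrite adde0; apply: (@le_trans _ _ (m%:R)%:E); last first.
      by rewrite lee_fin -ratr_nat ler_rat.
    rewrite sumEFin lee_fin -[in leRHS](subn0 m) -sumr_const_nat.
    by apply: ler_sum => i _; rewrite indicE lern1 leq_b1.
  rewrite indicE memNset // => wi; apply: nex; exists i.+1; split => //.
  by rewrite (lt_le_trans rm) // ler_nat.
- apply: (@lt_le_trans _ _ 0); first by rewrite lte_fin ltrq0.
  exact: nneseries_ge0.
- apply: lt_le_trans (nneseries_lim_ge k.+1 _) => [|i _ _]; last exact: ge0.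
  rewrite (eq_big_nat _ _ (F2 := fun=> 1%:E)) => [|i /andP[_ ik]].
    rewrite sumEFin sumr_const_nat subn0 lte_fin -ratr_nat.
    by rewrite ltr_rat.
  by rewrite indicE mem_set //; exact: small_ones_antitone wk.
Qed.

Lemma ones_test_integral Q : \int[Q]_w ones_test w Q <= 1.
Proof.
rewrite integral_nneseries //; last first.
  move=> k; apply/measurable_EFinP.
  by apply: measurable_indic; exact: measurable_small_ones.
apply: lime_le.
  apply: is_cvg_nneseries => k _ _; apply: integral_ge0 => w _.
  by rewrite lee_fin indicE ler0n.
apply: nearW => n.
apply: (@le_trans _ _ (\sum_(0 <= k < n) (ratr (bound k.+1))%:E)).
  apply: lee_sum => k _; rewrite integral_indic //; last first.
    exact: measurable_small_ones.
  by rewrite setIT small_ones_le.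
rewrite sumEFin lee_fin.
suff -> : (\sum_(0 <= k < n) ratr (bound k.+1) = 1 - (4%:R ^+ n)^-1 :> R)%R.
  by rewrite gerBl invr_ge0 exprn_ge0.
elim: n => [|n IH]; first by rewrite big_nil expr0 invr1 subrr.
rewrite big_nat_recr //= IH /bound fmorph_div rmorphXn /= !ratr_nat exprS.
by field; rewrite expf_neq0.
Qed.

Lemma ones_test_uniform : uniform_test ones_test.
Proof.
split; last exact: ones_test_integral.
split=> [w Q|].
  by apply: nneseries_ge0 => k _ _; rewrite lee_fin indicE ler0n.
have [c cP] := enumerated_basic_ones; exists c => r; rewrite cP.
apply/seteqP; split=> [[w Q] /ones_test_gtP [k [rk [n Qn wn]]]|].
  exists (basic_ones k n); first by exists k, n.
  split=> //= y u v; rewrite inE => /eqP[-> -> ->].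
  by rewrite Qn andbT (lt_le_trans _ (measure_ge0 _ _)) // lte_fin ltrq0.
move=> [w Q] [_ [k [n [rk ->]]] [/= wn Qn]]; apply/ones_test_gtP.
exists k; split=> //; exists n => //=.
by have /andP[] := Qn (ones n) (-1)%R (bound k) (mem_head _ _).
Qed.

(** By continuity from above, Q(1^n Omega) tends to 0 and drops below every [bound k], so 111...
    lies in all levels. *)
Lemma ones_test_true Q : Q (\bigcap_n cylinder (ones n)) = 0 ->
  ones_test (fun=> true) Q = +oo.
Proof.
move=> Q0; apply/eqyP => r r0.
have [m rm] : exists m : nat, (r <= m%:R)%R.
  by exists (Num.bound r); rewrite ltW // archi_boundP // ltW.
apply: (@le_trans _ _ (ratr m%:R)%:E); first by rewrite lee_fin ratr_nat.
apply/ltW/ones_test_gtP; exists m.+1; split; first by rewrite ltr_nat.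
have cvgQ : Q \o (fun n => cylinder (ones n)) @ \oo --> (0 : \bar R).
  rewrite -Q0; apply: nonincreasing_cvg_mu.
  - rewrite (le_lt_trans (probability_le1 _ _)) ?ltry //.
    exact: measurable_cylinder.
  - by move=> n; exact: measurable_cylinder.
  - by apply: bigcap_measurable => // n _; exact: measurable_cylinder.
  - by move=> i j ij; apply/subsetPset; exact: cylinder_ones_antitone.
have b0 : 0 < (ratr (bound m.+1))%:E :> \bar R.
  by rewrite lte_fin ltr0q divr_gt0 // exprn_gt0.
have [N _ QN] := cvgQ _ (open_ereal_lt' b0).
by exists N; [exact: QN (leqnn N)|apply/cylinder_onesE].
Qed.

End ones_test.

Import HBNNSimple.

(* As [f] need not be measurable, monotonicity of the integral does not apply;
   the simple function [r * \1_A] enters the supremum that defines it. *)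
Lemma ge0_integral_ge_cst d (T : measurableType d) (R : realType)
    (mu : {measure set T -> \bar R}) (f : T -> \bar R) (A : set T) (r : R) :
  measurable A -> (0 <= r)%R -> (forall x, 0 <= f x) ->
  (forall x, A x -> r%:E <= f x) -> r%:E * mu A <= \int[mu]_x f x.
Proof.
move=> mA r0 f0 fA; rewrite ge0_integralTE //.
apply: ereal_sup_ubound; exists (scale_nnsfun (indic_nnsfun R mA) r0).
  move=> x /=; rewrite mindicE.
  by case: (boolP (x \in A)) => [/set_mem/fA|_]; rewrite ?mulr1 ?mulr0.
by rewrite (sintegralrM mu r (indic_nnsfun R mA)) /= sintegral_indic.
Qed.

(** * The Poisson mixture of Dirac masses and the diagonal argument *)

Definition ones_zeros (N : nat -> nat) (k : nat) : Omega :=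
  fun i => (i < N k)%N.

Lemma measurable_ones_zeros N : measurable_fun [set: nat] (ones_zeros N).
Proof. by []. Qed.

HB.instance Definition _ N :=
  isMeasurableFun.Build _ _ _ _ (ones_zeros N) (measurable_ones_zeros N).

Section poisson_ones_zeros.
Context {R : realType}.

Local Notation poisson := (poisson_prob (1%R : R) 0).

Lemma poisson_prob_set1_gt0 k : 0 < poisson [set k].
Proof.
rewrite /poisson_prob ltr01 esum_set1 ?lee_fin ?poisson_pmf_ge0 //.
by rewrite lte_fin /poisson_pmf ltr01 !mulr_gt0 ?expR_gt0 ?exprn_gt0.
Qed.

Definition poisson_ones_zeros (N : nat -> nat) : probability Omega R :=
  distribution poisson (ones_zeros N).

(** The intersection is the single point 111..., while [ones_zeros N k] has a 0 at position
    [N k]. *)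
Lemma poisson_ones_zeros_true N :
  poisson_ones_zeros N (\bigcap_n cylinder (ones n)) = 0.
Proof.
rewrite /poisson_ones_zeros /= /distribution /pushforward.
rewrite (_ : _ @^-1` _ = set0) ?measure0 //.
apply/seteqP; split=> // k /(_ (N k).+1 I) /cylinder_onesE /(_ (N k) (ltnSn _)).
by rewrite /ones_zeros ltnn.
Qed.

Lemma poisson_ones_zeros_ge N k :
  poisson [set k] <= poisson_ones_zeros N (cylinder (ones (N k))).
Proof.
rewrite /poisson_ones_zeros /= /distribution /pushforward.
by apply: le_measure; rewrite ?inE // => _ ->; apply/cylinder_onesE.
Qed.

Lemma blindly_random_diagonal :
  exists N, blindly_random (poisson_ones_zeros N) (fun=> true).
Proof.
have step k : exists Nr : nat * rat, [/\ (0 <= Nr.2)%R,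
    1 < (ratr Nr.2)%:E * poisson [set k] &
    forall c, code_prf c = k ->
    (\bigcup_(x in enumerated code_word c Nr.2) cylinder x) (fun=> true) ->
    cylinder (ones Nr.1) `<=`
      \bigcup_(x in enumerated code_word c Nr.2) cylinder x].
  (* The weights do not depend on [N], so the threshold can be fixed before the prefix length. *)
  have [r r0 r1] : exists2 r : rat, (0 <= r)%R &
      1 < (ratr r)%:E * poisson [set k].
    have pk := poisson_prob_set1_gt0 k.
    have fk : poisson [set k] \is a fin_num by exact: fin_num_measure.
    set p := fine (poisson [set k]).
    have p0 : (0 < p)%R by rewrite fine_gt0 // pk ltey_eq fk.
    exists (Num.bound p^-1)%:R; first exact: ler0n.
    rewrite -(fineK fk) -EFinM lte_fin ratr_nat -ltr_pdivrMr // div1r.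
    by rewrite archi_boundP // invr_ge0 ltW.
  (* If algorithm k, run on [r], lists an interval around 111..., its word is 1^j and j is the
     prefix length; otherwise 0 will do. *)
  have [[c [ck [x xc /cylinder_const_true xE]]]|none] := pselect (exists c,
      code_prf c = k /\
      (\bigcup_(x in enumerated code_word c r) cylinder x) (fun=> true)).
    exists (size x, r); split=> //= c' c'k _ w wx.
    have -> : c' = c by apply: code_prf_inj; rewrite ck.
    by exists x => //; rewrite xE.
  by exists (0%N, r); split=> //= c ck cr; case: none; exists c.
have [Nr NrP] := choice step.
exists (fun k => (Nr k).1) => t [[t0 [c cP]] int_t].
rewrite ltey; apply/negP => /eqP tw.
have [r0 r1 /(_ c erefl)] := NrP (code_prf c).
set r := (Nr (code_prf c)).2 in r0 r1 *.
(* An infinite value at 111... exceeds [r], which puts this point in the open set listed by [c];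
   hence t > r on the whole chosen interval. *)
rewrite -cP /= tw => /(_ (ltry _)) sub.
have r0R : (0 <= ratr r :> R)%R by rewrite ler0q.
suff : 1 < \int[poisson_ones_zeros (fun k => (Nr k).1)]_w t w.
  by rewrite ltNge int_t.
apply: (lt_le_trans r1).
have := ge0_integral_ge_cst (poisson_ones_zeros (fun k => (Nr k).1))
  (measurable_cylinder (ones (Nr (code_prf c)).1)) r0R t0
  (fun x xN => ltW (sub x xN)).
apply: le_trans; apply: lee_wpmul2l; first by rewrite lee_fin.
exact: (poisson_ones_zeros_ge (fun k => (Nr k).1)).
Qed.

End poisson_ones_zeros.

Theorem theorem20 (R : realType) :
  exists (P : probability Omega R) (w : Omega),
    blindly_random P w /\ ~ uniformly_random P w.
Proof.
have [N Nrandom] := @blindly_random_diagonal R.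
exists (poisson_ones_zeros N), (fun=> true); split=> // -[u [_ uU] u_fin].
(* Universality bounds [ones_test] by a multiple of [u], which is therefore infinite at 111...
   too. *)
have [a a0 le_u] := uU _ ones_test_uniform.
have := le_u (fun=> true) (poisson_ones_zeros N).
rewrite ones_test_true ?poisson_ones_zeros_true // leye_eq => /eqP u_infty.
have : a%:E * u (fun=> true) (poisson_ones_zeros N) < +oo.
  by rewrite lte_mul_pinfty // lee_fin ltW.
by rewrite u_infty ltxx.
Qed.
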